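(* Let $$\tilde{\mathcal J}=-\sigma^{-1}\ln\left(\mathbb E\left[e^{-\sigma\tilde{\mathcal L}}\mid u_{0:T-1}\right]\right),\qquad \tilde{\mathcal L}=\sum_{t=0}^T\left(\bar l_t+\tfrac12\delta x_t^Tl^{xx}_t\delta x_t+l^{x^T}_t\delta x_t\right),$$ subject to $\delta x_0=x_0-\hat x_0$ and $\delta x_{t+1}=f^x_t\delta x_t+\bar f_{t+1}+\omega_{t+1}$. Then $$\tilde{\mathcal J}=\sigma^{-1}\ln(\alpha)+\bar v_0-\tfrac12v_0^T\left(V_0+\sigma^{-1}\chi_0^{-1}\right)^{-1}v_0,$$ with $$\alpha=\left|I+\sigma V_0\chi_0\right|^{1/2}\prod_{t=1}^T\left|I+\sigma V_t\Omega_t\right|^{1/2},$$ and where $\bar v_0,v_0,V_0$ are the terminal values of the (backward in $t$) recursion $$V_t=l^{xx}_t+f^{x^T}_tM_tf^x_t,$$ $$v_t=l^x_t+f^{x^T}_tM_t\bar f_{t+1}+f^{x^T}_tN_t,$$ $$\bar v_t=\bar l_t+\bar v_{t+1}+\bar f_{t+1}^TN_t+\tfrac12\bar f_{t+1}^TM_t\bar f_{t+1}-\tfrac12v_{t+1}^T\left(V_{t+1}+\sigma^{-1}\Omega_{t+1}^{-1}\right)^{-1}v_{t+1},$$ where $M_t=\left(\sigma\Omega_{t+1}+V_{t+1}^{-1}\right)^{-1}$ and $N_t=v_{t+1}-\sigma M_t\Omega_{t+1}v_{t+1}$ are evaluated with the $V$ and $v$ of this recursion.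
   Context: $|A|$ denotes the determinant of a matrix $A$. Fix a horizon $T$ and a scalar sensitivity parameter $\sigma$. The system is $x_{t+1}=f_t(x_t,u_t)+\omega_{t+1}$, with $x_0\sim\mathcal N(\hat x_0,\chi_0)$ and independent Gaussian noises $\omega_t\sim\mathcal N(0,\Omega_t)$, and the cost is $l_T(x_T)+\sum_{t=0}^{T-1}l_t(x_t,u_t)$. All functions are $\mathcal C^2$. A fixed candidate control sequence $u_{0:T-1}$ and a nominal state trajectory $x^n_0,\dots,x^n_T$ (not necessarily dynamically feasible) are given; $\delta x_t$ is the state deviation from the nominal trajectory in the linearized model. $f^x_t$ is the Jacobian of $f_t$ in $x$, and $l^x_t,l^{xx}_t$ are the gradient and Hessian of $l_t$ in $x$, all evaluated along the nominal states and candidate controls; $\bar f_{t+1}=f_t(x^n_t,u_t)-x^n_{t+1}$ is the feasibility gap; $\bar l_t=l_t(x^n_t,u_t)$ is the cost at the nominal point (for $t=T$ it is $l_T(x^n_T)$, with no control). The expectation is over the random $x_0$ and $\omega_{1:T}$. The recursion runs backward from $t=T$, where its starting values are the coefficients of the terminal cost: $V_T=l^{xx}_T$, $v_T=l^x_T$, $\bar v_T=\bar l_T$.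
   Formalization: The formal theorem assumes that the expectation of exp(-σL̃) is finite (otherwise J̃ is infinite and the formula can fail), and, as the formulas require, that σ is nonzero, V_t is invertible for 1 ≤ t ≤ T, and the noise covariances are positive definite. *)

(* Defs.v *)
From HB Require Import structures.
From mathcomp Require Import all_boot all_order all_algebra.
From mathcomp Require Import all_classical all_reals all_analysis.

Set Implicit Arguments.
Unset Strict Implicit.
Unset Printing Implicit Defensive.

Import Order.TTheory GRing.Theory Num.Theory.
Import numFieldNormedType.Exports.

Local Open Scope classical_set_scope.
Local Open Scope ring_scope.

Definition dotv (R : realType) (n : nat) (x y : 'cV[R]_n) : R :=
  (x^T *m y) 0 0.

Definition posdefmx (R : realType) (n : nat) (S : 'M[R]_n) : Prop :=
  S^T = S /\ forall x : 'cV[R]_n, x != 0 -> 0 < dotv x (S *m x).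

(* In finite dimension, continuity of all directional derivatives of order at
   most k is equivalent to being k times continuously differentiable. *)
Definition classC1 (R : realType) (V W : normedModType R) (g : V -> W) : Prop :=
  forall v : V, (forall x, derivable g x v) /\
                continuous (fun x => derive g x v).

Definition classC2 (R : realType) (V W : normedModType R) (g : V -> W) : Prop :=
  classC1 g /\ forall v : V, classC1 (fun x => derive g x v).

Definition gradient (R : realType) (n : nat) (g : 'cV[R]_n -> R)
    (x : 'cV[R]_n) : 'cV[R]_n :=
  \col_i derive g x (delta_mx i 0).

Definition hessian (R : realType) (n : nat) (g : 'cV[R]_n -> R)
    (x : 'cV[R]_n) : 'M[R]_n :=
  \matrix_(i, j) derive (fun y => derive g y (delta_mx j 0)) x (delta_mx i 0).

(* The library's [jacobian] acts on row vectors and is the transpose of this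
   matrix. *)
Definition jacobian_col (R : realType) (n k : nat) (g : 'cV[R]_n -> 'cV[R]_k)
    (x : 'cV[R]_n) : 'M[R]_(k, n) :=
  \matrix_(i, j) derive (fun y => g y i 0) x (delta_mx j 0).

(* The sigma-algebra on R^n generated by the coordinates, i.e. the Borel
   sigma-algebra. *)
Definition measure_cV_display : measure_display.
Proof. exact: default_measure_display. Qed.

Definition cV_coord (R : realType) (n : nat) (i : 'I_n) (x : 'cV[R]_n) :
  measurableTypeR R := x i 0.

Definition measurable_cV (R : realType) (n : nat) : set (set 'cV[R]_n) :=
  g_sigma_preimage (@cV_coord R n).

Lemma measurable_cV0 (R : realType) (n : nat) : @measurable_cV R n set0.
Proof. exact: sigma_algebra0. Qed.

Lemma measurable_cVC (R : realType) (n : nat) (A : set 'cV[R]_n) :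
  measurable_cV A -> measurable_cV (~` A).
Proof. exact: sigma_algebraC. Qed.

Lemma measurable_cV_bigcup (R : realType) (n : nat) (F : (set 'cV[R]_n)^nat) :
  (forall i, measurable_cV (F i)) -> measurable_cV (\bigcup_i F i).
Proof. exact: sigma_algebra_bigcup. Qed.

HB.instance Definition _ (R : realType) (n : nat) :=
  @isMeasurable.Build measure_cV_display 'cV[R]_n (@measurable_cV R n)
    (@measurable_cV0 R n) (@measurable_cVC R n) (@measurable_cV_bigcup R n).

(* Lebesgue integral over R^n as the iterated integral, one coordinate after the
   other; it is only used on nonnegative measurable functions, where Tonelli's
   theorem applies. *)
Fixpoint integral_cV (R : realType) (n : nat) :
    ('cV[R]_n -> \bar R) -> \bar R :=
  match n with
  | 0 => fun g => g 0
  | n'.+1 => fun g => (\int[@lebesgue_measure R]_x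
      integral_cV (fun y : 'cV[R]_n' => g (col_mx (x%:M : 'M[R]_1) y)))%E
  end.

Definition gaussian_pdf (R : realType) (n : nat) (m : 'cV[R]_n) (S : 'M[R]_n)
    (x : 'cV[R]_n) : R :=
  (Num.sqrt ((2 * pi) ^+ n * \det S))^-1 *
  expR (- (2^-1 * dotv (x - m) (invmx S *m (x - m)))).

(* X ~ N(m, S), nondegenerate *)
Definition gaussian (d : measure_display) (Omega : measurableType d)
    (R : realType) (P : probability Omega R) (n : nat)
    (X : {RV P >-> 'cV[R]_n}) (m : 'cV[R]_n) (S : 'M[R]_n) : Prop :=
  posdefmx S /\
  forall B : set 'cV[R]_n, measurable B ->
    distribution P X B =
    integral_cV (fun x => (\1_B x * gaussian_pdf m S x)%:E).

(* Independence of finite subfamilies is the case where some B i are setT. *)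
Definition mutually_independent (d : measure_display) (Omega : measurableType d)
    (R : realType) (P : probability Omega R) (n N : nat)
    (X : 'I_N -> {RV P >-> 'cV[R]_n}) : Prop :=
  forall B : 'I_N -> set 'cV[R]_n, (forall i, measurable (B i)) ->
    P (\bigcap_(i in [set: 'I_N]) (X i @^-1` B i)) =
    (\prod_(i < N) P (X i @^-1` B i))%E.

(* The family x_0, w_1, w_2, ... of primitive random vectors (w 0 is unused). *)
Definition noise (d : measure_display) (Omega : measurableType d)
    (R : realType) (P : probability Omega R) (n : nat)
    (x0 : {RV P >-> 'cV[R]_n}) (w : nat -> {RV P >-> 'cV[R]_n}) (t : nat) :
    {RV P >-> 'cV[R]_n} :=
  if t is 0 then x0 else w t.

(* x |-> l_t(x, u_t) for t < T, and x |-> l_T(x) for t = T *)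
Definition cost_at (R : realType) (n m T : nat)
    (l : nat -> 'cV[R]_n -> 'cV[R]_m -> R) (lT : 'cV[R]_n -> R)
    (u : nat -> 'cV[R]_m) (t : nat) : 'cV[R]_n -> R :=
  if (t < T)%N then fun x => l t x (u t) else lT.

Definition gap (R : realType) (n m : nat)
    (f : nat -> 'cV[R]_n -> 'cV[R]_m -> 'cV[R]_n)
    (u : nat -> 'cV[R]_m) (xn : nat -> 'cV[R]_n) (t : nat) : 'cV[R]_n :=
  if t is s.+1 then f s (xn s) (u s) - xn s.+1 else 0.

(* The random total cost of the linear-quadratic model, sum for t = 0, ..., T. *)
Definition Ltilde (R : realType) (n : nat) (Omega : Type) (T : nat)
    (lbar : nat -> R) (lx : nat -> 'cV[R]_n) (lxx : nat -> 'M[R]_n)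
    (dx : nat -> Omega -> 'cV[R]_n) (om : Omega) : R :=
  \sum_(0 <= t < T.+1)
    (lbar t + 2^-1 * dotv (dx t om) (lxx t *m dx t om) + dotv (lx t) (dx t om)).

Definition Jtilde (d : measure_display) (Omega : measurableType d)
    (R : realType) (P : probability Omega R) (sigma : R) (L : Omega -> R) : R :=
  - sigma^-1 * ln (fine 'E_P[fun om => expR (- sigma * L om)]).

Definition Mmx (R : realType) (n : nat) (sigma : R) (Om : nat -> 'M[R]_n)
    (V : nat -> 'M[R]_n) (t : nat) : 'M[R]_n :=
  invmx (sigma *: Om t.+1 + invmx (V t.+1)).

Definition Nvec (R : realType) (n : nat) (sigma : R) (Om : nat -> 'M[R]_n)
    (V : nat -> 'M[R]_n) (v : nat -> 'cV[R]_n) (t : nat) : 'cV[R]_n :=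
  v t.+1 - sigma *: (Mmx sigma Om V t *m Om t.+1 *m v t.+1).

Definition alpha (R : realType) (n : nat) (sigma : R) (chi0 : 'M[R]_n)
    (Om V : nat -> 'M[R]_n) (T : nat) : R :=
  Num.sqrt (\det (1%:M + sigma *: (V 0%N *m chi0))) *
  \prod_(1 <= t < T.+1) Num.sqrt (\det (1%:M + sigma *: (V t *m Om t))).

(* Main.v *)
Require Import Defs.
From HB Require Import structures.
From mathcomp Require Import all_boot all_order all_algebra.
From mathcomp Require Import all_classical all_reals all_analysis.
From mathcomp Require Import measurable_realfun ring lra.

Set Implicit Arguments.
Unset Strict Implicit.
Unset Printing Implicit Defensive.

Import Order.TTheory GRing.Theory Num.Theory.
Import numFieldNormedType.Exports.

Local Open Scope classical_set_scope.
Local Open Scope ring_scope.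

(** The exponential of the quadratic model is integrated out one noise at a time,
from the last one to the first.

Write [q_t(x) = vbar_t + v_t . x + x . V_t x / 2]. Given the noises before time
[t], the deviation is [dx_t = y + z], where [y] is determined by the past and
[z] is a centred Gaussian of covariance [S] independent of it. Completing the
square in [z] gives
[[
  E [exp (- sigma q_t(y + z))] = det (1 + sigma V_t S)^(-1/2) exp (- sigma r_t(y))
]]
where [r_t(y) = q_t(y)
  - (sigma/2) (v_t + V_t y) . (S^-1 + sigma V_t)^-1 (v_t + V_t y)]
([integral_gaussian_qform]). The matrix identities
[V (S^-1 + sigma V)^-1 = M S] and
[V - sigma V (S^-1 + sigma V)^-1 V = M] turn [r_t] into the polynomial with
quadratic part [M] and linear part [N] ([smoothedE]). Substituting
[y = f^x dx_(t-1) + fbar_t] and adding the stage cost of time [t - 1] yields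
exactly [q_(t-1)(dx_(t-1))] ([qform_affine]), so the recursion is a dynamic
programming equation. At [t = 0] one has [y = 0]; the accumulated determinants
are [alpha].

Three points need care.

- The sign of [sigma] is arbitrary, so the Gaussian integrals may diverge. For a
  symmetric matrix [Q] either [det Q > 0] and all the integrals of
  [exp (- z . Q z / 2 + b . z + c)] have their usual finite value, or all of them
  are infinite, whatever [b] and [c] are ([integral_cV_gaussian]). The second
  alternative at a single stage would make the whole expectation infinite, so the
  one integrability hypothesis gives [det (1 + sigma V_t S) > 0] at every stage
  ([expected_step]).

- Completing the square needs [V_t] symmetric, which comes from the symmetry of
  the Hessian of a function of class C2 ([derive_comm], [hessian_sym]).

- Conditioning on the past is expressed by Tonelli's theorem on the product of
  the probability space, equipped with the sigma-algebra of the past, with the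
  space of the current noise ([integral_past]). *)

(** * Measurable vector-valued functions *)

Lemma measurable_fun_cVP (R : realType) (n : nat) (d : measure_display)
    (T : measurableType d) (h : T -> 'cV[R]_n) :
  measurable_fun [set: T] h <->
  forall i, measurable_fun [set: T] (fun t => h t i 0 : measurableTypeR R).
Proof.
apply: (@iff_trans _ (g_sigma_preimage
    (fun i : 'I_n => (fun t => @cV_coord R n i (h t))) `<=` measurable)).
- rewrite (g_sigma_preimage_comp (@cV_coord R n) h); split=> [mf A [/= C preC <-]|prefS].
    exact: mf.
  by move=> _ A mA; apply: prefS; exists A.
- split=> [hS i|mh].
    move=> _ A mA; apply: hS; apply: sub_sigma_algebra.
    rewrite -bigcup_seq/=; exists i; first by rewrite /= mem_index_enum.
    by exists A.
  apply: smallest_sub; first exact: sigma_algebra_measurable.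
  rewrite -bigcup_seq => A [i _] [B mB <-]; exact: mh.
Qed.

Section measurable_vector_functions.
Context (R : realType) (d : measure_display) (T : measurableType d).

Lemma measurable_coordT n (h : T -> 'cV[R]_n) i : measurable_fun setT h ->
  measurable_fun setT (fun t => h t i 0 : measurableTypeR R).
Proof. by move=> mh; move: i; apply/measurable_fun_cVP. Qed.

Lemma measurable_mulmx n k (A : 'M[R]_(k, n)) (h : T -> 'cV[R]_n) :
  measurable_fun setT h -> measurable_fun setT (fun t => A *m h t).
Proof.
move=> mh; apply/measurable_fun_cVP => i.
under eq_fun do rewrite mxE.
apply: measurable_sum => j; apply: measurable_funM; first exact: measurable_cst.
exact: measurable_coordT.
Qed.

Lemma measurable_addmx n (g h : T -> 'cV[R]_n) :
  measurable_fun setT g -> measurable_fun setT h ->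
  measurable_fun setT (fun t => g t + h t).
Proof.
move=> mg mh; apply/measurable_fun_cVP => i.
under eq_fun do rewrite mxE.
by apply: measurable_funD; exact: measurable_coordT.
Qed.

Lemma measurable_dotv n (g h : T -> 'cV[R]_n) :
  measurable_fun setT g -> measurable_fun setT h ->
  measurable_fun setT (fun t => dotv (g t) (h t) : measurableTypeR R).
Proof.
move=> mg mh.
under eq_fun do rewrite /dotv mxE.
apply: measurable_sum => j; under eq_fun do rewrite mxE.
by apply: measurable_funM; exact: measurable_coordT.
Qed.

End measurable_vector_functions.

Lemma measurable_col_mx (R : realType) (n : nat) (d : measure_display)
    (T : measurableType d) (g : T -> measurableTypeR R) (h : T -> 'cV[R]_n) :
  measurable_fun setT g -> measurable_fun setT h ->
  measurable_fun setT (fun t => col_mx ((g t)%:M : 'M[R]_1) (h t) : 'cV[R]_n.+1).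
Proof.
move=> mg mh; apply/(@measurable_fun_cVP R n.+1) => i.
under eq_fun do rewrite (mxE col_mx_key).
case: splitP => j _.
  rewrite (_ : (fun t => _) = g)//; apply/funext => t.
  by rewrite ord1 mxE mulr1n.
exact: measurable_coordT.
Qed.

(** * The iterated integral as an integral against a density *)

Lemma measurable_fun_uncurry (d d1 d2 d3 : measure_display)
    (T : measurableType d) (T1 : measurableType d1) (T2 : measurableType d2)
    (T3 : measurableType d3) (g : T1 -> T2 -> T3) (a : T -> T1) (b : T -> T2) :
  measurable_fun setT (fun z : T1 * T2 => g z.1 z.2) ->
  measurable_fun setT a -> measurable_fun setT b ->
  measurable_fun setT (fun t => g (a t) (b t)).
Proof.
by move=> mg ma mb; exact: (measurableT_comp mg (measurable_fun_pair ma mb)).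
Qed.

Lemma integral_cV_ge0 (R : realType) n (g : 'cV[R]_n -> \bar R) :
  (forall x, 0 <= g x)%E -> (0 <= integral_cV g)%E.
Proof.
elim: n g => [|n IH] g g0 /=; first exact: g0.
by apply: integral_ge0 => x _; apply: IH.
Qed.

Lemma eq_integral_cV (R : realType) n (g h : 'cV[R]_n -> \bar R) :
  (forall x, g x = h x) -> integral_cV g = integral_cV h.
Proof. by move=> gh; congr integral_cV; apply/funext. Qed.

(** The parameter space is universally quantified so that the induction can move
one coordinate at a time from the integrated vector to the parameter. *)
Lemma measurable_integral_cV (R : realType) (n : nat) (d : measure_display)
    (T : measurableType d) (g : T -> 'cV[R]_n -> \bar R) :
  measurable_fun [set: T * 'cV[R]_n] (fun z => g z.1 z.2) ->
  (forall t x, 0 <= g t x)%E ->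
  measurable_fun [set: T] (fun t => integral_cV (g t)).
Proof.
elim: n d T g => [|n IH] d T g mg g0 /=.
  have := @measurable_fun_uncurry _ _ _ _ T T 'cV[R]_0 (\bar R) g id (fun=> 0) mg.
  by apply.
pose F (z : T * measurableTypeR R) :=
  integral_cV (fun y : 'cV[R]_n => g z.1 (col_mx (z.2%:M : 'M[R]_1) y)).
have mF : measurable_fun setT F.
  apply: IH => [|t x]; last exact: g0.
  apply: (measurable_fun_uncurry mg) => /=; first exact: measurableT_comp.
  by apply: measurable_col_mx => //; exact: measurableT_comp.
apply: (measurable_fun_fubini_tonelli_F (m2 := @lebesgue_measure R) F mF).
by move=> z; apply: integral_cV_ge0.
Qed.

Section integral_cV_functional.
Context (R : realType).

Let slice n (g : 'cV[R]_n.+1 -> \bar R) (x : measurableTypeR R) :=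
  fun y : 'cV[R]_n => g (col_mx (x%:M : 'M[R]_1) y).

Lemma measurable_slice n (g : 'cV[R]_n.+1 -> \bar R) x :
  measurable_fun setT g -> measurable_fun setT (slice g x).
Proof. by move=> mg; apply: (measurableT_comp mg); exact: measurable_col_mx. Qed.

Lemma measurable_integral_slice n (g : 'cV[R]_n.+1 -> \bar R) :
  measurable_fun setT g -> (forall x, 0 <= g x)%E ->
  measurable_fun setT (fun x => integral_cV (slice g x)).
Proof.
move=> mg g0; apply: measurable_integral_cV => [|*]; last exact: g0.
by apply: (measurableT_comp mg); exact: measurable_col_mx.
Qed.

Lemma integral_cV0 n : integral_cV (fun _ : 'cV[R]_n => 0%E) = 0%E.
Proof. by elim: n => //= n IH; rewrite integral0_eq. Qed.

Lemma le_integral_cV n (g h : 'cV[R]_n -> \bar R) :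
  measurable_fun setT g -> measurable_fun setT h ->
  (forall x, 0 <= g x)%E -> (forall x, g x <= h x)%E ->
  (integral_cV g <= integral_cV h)%E.
Proof.
elim: n g h => [|n IH] g h mg mh g0 gh /=; first exact: gh.
have h0 x : (0 <= h x)%E by exact: le_trans (gh x).
apply: ge0_le_integral => //.
- by move=> *; exact: integral_cV_ge0.
- exact: measurable_integral_slice.
- exact: measurable_integral_slice.
- by move=> x _; apply: IH => //; exact: measurable_slice.
Qed.

Lemma integral_cVD n (g h : 'cV[R]_n -> \bar R) :
  measurable_fun setT g -> measurable_fun setT h ->
  (forall x, 0 <= g x)%E -> (forall x, 0 <= h x)%E ->
  integral_cV (fun x => g x + h x)%E = (integral_cV g + integral_cV h)%E.
Proof.
elim: n g h => [//|n IH] g h mg mh g0 h0 /=.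
rewrite -ge0_integralD//.
- apply: eq_integral => x _; apply: IH => //; exact: measurable_slice.
- by move=> *; exact: integral_cV_ge0.
- exact: measurable_integral_slice.
- by move=> *; exact: integral_cV_ge0.
- exact: measurable_integral_slice.
Qed.

Lemma integral_cVZl n (k : R) (g : 'cV[R]_n -> \bar R) : 0 <= k ->
  measurable_fun setT g -> (forall x, 0 <= g x)%E ->
  integral_cV (fun x => k%:E * g x)%E = (k%:E * integral_cV g)%E.
Proof.
move=> k0; elim: n g => [//|n IH] g mg g0 /=.
rewrite -ge0_integralZl//.
- apply: eq_integral => x _; apply: IH => //; exact: measurable_slice.
- exact: measurable_integral_slice.
- by move=> *; exact: integral_cV_ge0.
Qed.

Lemma integral_cV_sum n (I : eqType) (s : seq I) (g : I -> 'cV[R]_n -> \bar R) :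
  (forall i, measurable_fun setT (g i)) ->
  (forall i x, i \in s -> 0 <= g i x)%E ->
  integral_cV (fun x => \sum_(i <- s) g i x)%E =
  (\sum_(i <- s) integral_cV (g i))%E.
Proof.
move=> mg; elim: s => [|i s IH] g0.
  by rewrite big_nil -[RHS](integral_cV0 n); apply: eq_integral_cV => x; rewrite big_nil.
have {}IH := IH (fun j x js => g0 j x (@mem_behead _ (i :: s) j js)).
rewrite big_cons -IH -integral_cVD//.
- by apply: eq_integral_cV => x; rewrite big_cons.
- exact: emeasurable_sum.
- by move=> x; apply: g0; rewrite mem_head.
- move=> x; rewrite big_seq; apply: sume_ge0 => j js.
  by apply: g0; rewrite inE js orbT.
Qed.

(** Monotone convergence, applied once per coordinate. *)
Lemma cvg_integral_cV n (g : nat -> 'cV[R]_n -> \bar R) (h : 'cV[R]_n -> \bar R) :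
  (forall k, measurable_fun setT (g k)) -> (forall k x, 0 <= g k x)%E ->
  (forall x, nondecreasing_seq (g ^~ x)) ->
  (forall x, g ^~ x @ \oo --> h x) ->
  (fun k => integral_cV (g k)) @ \oo --> integral_cV h.
Proof.
elim: n g h => [|n IH] g h mg g0 ndg gh /=; first exact: gh.
have -> : (\int[@lebesgue_measure R]_x integral_cV (slice h x))%E =
    (\int[@lebesgue_measure R]_x limn (fun k => integral_cV (slice (g k) x)))%E.
  apply: eq_integral => x _; apply/esym/cvg_lim => //.
  apply: (IH (fun k => slice (g k) x)) => [k|k y|y|y].
  - exact: measurable_slice.
  - exact: g0.
  - exact: ndg.
  - exact: gh.
apply: cvg_monotone_convergence => //.
- by move=> k; exact: measurable_integral_slice.
- by move=> k x _; exact: integral_cV_ge0.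
- move=> x _ k k' kk'; apply: le_integral_cV => [||y|y].
  + exact: measurable_slice.
  + exact: measurable_slice.
  + exact: g0.
  + exact: ndg.
Qed.

End integral_cV_functional.

Section density.
Context (R : realType) (n : nat) (mu : {measure set 'cV[R]_n -> \bar R}).
Variable p : 'cV[R]_n -> R.
Hypotheses (mp : measurable_fun setT (p : _ -> measurableTypeR R))
  (p0 : forall x, 0 <= p x).
Hypothesis mu_p : forall B, measurable B ->
  mu B = integral_cV (fun x => (\1_B x * p x)%:E).

Import HBNNSimple.

(** The case of simple functions, from which [integral_density] follows by monotone
convergence. *)
Lemma integral_density_nnsfun (g : {nnsfun 'cV[R]_n >-> R}) :
  (\int[mu]_x (g x)%:E)%E = integral_cV (fun x => (g x)%:E * (p x)%:E)%E.
Proof.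
rewrite integralT_nnsfun sintegralE.
have fg : finite_set (range g) by exact: fimfunP.
rewrite fsbig_finite//=.
(* The values of [g] are nonnegative, hence so are all the summands below. *)
set s := finmap.enum_fset _.
have s0 r : r \in s -> 0 <= r.
  by rewrite /s in_fset_set// inE => -[y _ <-].
have mr r : measurable_fun [set: 'cV[R]_n]
    (fun x => (\1_(g @^-1` [set r]) x * p x)%:E).
  by apply/measurable_EFinP/measurable_funM => //; exact: measurable_indic.
transitivity (\sum_(r <- s)
    integral_cV (fun x => r%:E * (\1_(g @^-1` [set r]) x * p x)%:E))%E.
  rewrite big_seq [RHS]big_seq; apply: eq_bigr => r /s0 r0.
  rewrite mu_p// integral_cVZl// => x.
  by rewrite lee_fin mulr_ge0.
rewrite -integral_cV_sum.
- apply: eq_integral_cV => x; rewrite fimfunE fsbig_finite//= -/s.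
  transitivity (\sum_(r <- s) (r * (\1_(g @^-1` [set r]) x * p x))%:E)%E.
    by apply: eq_bigr.
  rewrite sumEFin -[RHS]EFinM mulr_suml; congr EFin.
  by apply: eq_bigr => r _; rewrite mulrA.
- by move=> r; exact: measurable_funeM.
- by move=> r x /s0 r0; rewrite mule_ge0 ?lee_fin// mulr_ge0.
Qed.

Lemma integral_density (g : 'cV[R]_n -> \bar R) :
  measurable_fun setT g -> (forall x, 0 <= g x)%E ->
  (\int[mu]_x g x)%E = integral_cV (fun x => g x * (p x)%:E)%E.
Proof.
move=> mg g0; pose h := nnsfun_approx measurableT mg.
have hg x : (EFin \o h ^~ x) @ \oo --> g x.
  by apply: cvg_nnsfun_approx => // y _; exact: g0.
have hnd x : nondecreasing_seq (EFin \o h ^~ x).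
  by move=> k k' kk'; rewrite lee_fin; exact/lefP/nd_nnsfun_approx.
have h1 : (fun k => \int[mu]_x (h k x)%:E)%E @ \oo --> (\int[mu]_x g x)%E.
  have -> : (\int[mu]_x g x = \int[mu]_x limn (EFin \o h ^~ x))%E.
    by apply: eq_integral => x _; apply/esym/cvg_lim.
  apply: cvg_monotone_convergence => //.
  - by move=> k; exact/measurable_EFinP.
  - by move=> k x _; rewrite lee_fin.
  - by move=> x _; exact: hnd.
have h2 : (fun k => \int[mu]_x (h k x)%:E)%E @ \oo -->
    integral_cV (fun x => g x * (p x)%:E)%E.
  under eq_fun do rewrite integral_density_nnsfun.
  apply: cvg_integral_cV => [k|k x|x|x].
  - by apply: emeasurable_funM; exact/measurable_EFinP.
  - by rewrite mule_ge0 ?lee_fin.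
  - by move=> k k' kk'; rewrite lee_wpmul2r ?lee_fin//; exact: hnd.
  - by apply: cvgeZr => //; exact: hg.
by rewrite -(cvg_lim _ h1)// (cvg_lim _ h2).
Qed.

End density.
(** * Gaussian integrals *)

Section dot_product.
Context (R : realType).

Lemma dotvC n (x y : 'cV[R]_n) : dotv x y = dotv y x.
Proof. by rewrite /dotv -{1}(trmxK y) -trmx_mul mxE. Qed.

Lemma dotvDr n (x y z : 'cV[R]_n) : dotv x (y + z) = dotv x y + dotv x z.
Proof. by rewrite /dotv mulmxDr mxE. Qed.

Lemma dotvDl n (x y z : 'cV[R]_n) : dotv (x + y) z = dotv x z + dotv y z.
Proof. by rewrite !(dotvC _ z) dotvDr. Qed.

Lemma dotvZr n (a : R) (x y : 'cV[R]_n) : dotv x (a *: y) = a * dotv x y.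
Proof. by rewrite /dotv -scalemxAr mxE. Qed.

Lemma dotvZl n (a : R) (x y : 'cV[R]_n) : dotv (a *: x) y = a * dotv x y.
Proof. by rewrite !(dotvC _ y) dotvZr. Qed.

Lemma dotvNr n (x y : 'cV[R]_n) : dotv x (- y) = - dotv x y.
Proof. by rewrite -scaleN1r dotvZr mulN1r. Qed.

Lemma dotvNl n (x y : 'cV[R]_n) : dotv (- x) y = - dotv x y.
Proof. by rewrite !(dotvC _ y) dotvNr. Qed.

Lemma dotv0r n (x : 'cV[R]_n) : dotv x 0 = 0.
Proof. by rewrite /dotv mulmx0 mxE. Qed.

Lemma dotv_mulmx n k (A : 'M[R]_(n, k)) (x : 'cV[R]_n) (y : 'cV[R]_k) :
  dotv x (A *m y) = dotv (A^T *m x) y.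
Proof. by rewrite /dotv trmx_mul trmxK mulmxA. Qed.

Lemma dotv_sym n (Q : 'M[R]_n) (x y : 'cV[R]_n) : Q^T = Q ->
  dotv x (Q *m y) = dotv y (Q *m x).
Proof. by move=> QT; rewrite dotv_mulmx QT dotvC. Qed.

Lemma dotv_col n (a b : R) (y z : 'cV[R]_n) :
  dotv (col_mx (a%:M : 'M[R]_1) y) (col_mx (b%:M : 'M[R]_1) z) = a * b + dotv y z.
Proof.
by rewrite /dotv tr_col_mx mul_row_col mxE tr_scalar_mx -scalar_mxM mxE mulr1n.
Qed.

Definition dotvE := (dotvDl, dotvDr, dotvZl, dotvZr, dotvNl, dotvNr).

End dot_product.

Section gaussian_line.
Context (R : realType).
Local Notation mu := (@lebesgue_measure R).

(** Up to a constant factor the integrand is the normal density of mean [beta / s]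
and variance [1 / s]. *)
Lemma integral_expR_quadratic (s beta c : R) : 0 < s ->
  (\int[mu]_x (expR (- (2^-1 * (s * x ^+ 2)) + beta * x + c))%:E =
   (Num.sqrt (2 * pi / s) * expR (c + 2^-1 * (beta ^+ 2 / s)))%:E)%E.
Proof.
move=> s0; have sn0 : s != 0 by rewrite gt_eqF.
pose sd := Num.sqrt s^-1; have sd0 : sd != 0 by rewrite gt_eqF// sqrtr_gt0 invr_gt0.
have sd2 : sd ^+ 2 = s^-1 by rewrite sqr_sqrtr// invr_ge0 ltW.
pose K := Num.sqrt (2 * pi / s) * expR (c + 2^-1 * (beta ^+ 2 / s)).
have K0 : 0 <= K by rewrite mulr_ge0 ?sqrtr_ge0 ?expR_ge0.
have E x : expR (- (2^-1 * (s * x ^+ 2)) + beta * x + c) =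
    K * normal_pdf (beta / s) sd x.
  rewrite normal_pdfE// /normal_peak /normal_fun sd2.
  have -> : s^-1 * pi *+ 2 = 2 * pi / s by rewrite -mulr_natl; field.
  rewrite /K mulrACA mulfV ?mul1r; last first.
    by rewrite gt_eqF// sqrtr_gt0 divr_gt0// mulr_gt0// pi_gt0.
  rewrite -expRD; congr expR.
  by rewrite -mulr_natl; field; rewrite ?sn0.
under eq_integral do rewrite E EFinM.
rewrite ge0_integralZl_EFin//; first by rewrite integral_normal_pdf mule1.
- by move=> x _; rewrite lee_fin normal_pdf_ge0.
- by apply/measurable_EFinP; exact: measurable_normal_pdf.
Qed.

Lemma measurable_expR_quadratic (s beta c : R) :
  measurable_fun [set: measurableTypeR R]
    (fun x => expR (- (2^-1 * (s * x ^+ 2)) + beta * x + c) : measurableTypeR R).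
Proof.
apply: measurableT_comp => //; apply: measurable_funD => //.
apply: measurable_funD.
  apply: measurable_funN; apply: measurable_funM; first exact: measurable_cst.
  by apply: measurable_funM; [exact: measurable_cst|exact: measurable_funX].
by apply: measurable_funM; [exact: measurable_cst|exact: measurable_id].
Qed.

(** On the half-line where [beta * x] is nonnegative the integrand is at least
[expR c]. *)
Lemma integral_expR_quadratic_infty (s beta c : R) : s <= 0 ->
  (\int[mu]_x (expR (- (2^-1 * (s * x ^+ 2)) + beta * x + c))%:E = +oo)%E.
Proof.
move=> s0.
have ray (D : set (measurableTypeR R)) : measurable D -> mu D = +oo%E ->
    (forall x, D x -> 0 <= beta * x) ->
    (\int[mu]_x (expR (- (2^-1 * (s * x ^+ 2)) + beta * x + c))%:E = +oo)%E.
  move=> mD muD Db; apply/eqP; rewrite -leye_eq.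
  have mE : measurable_fun [set: measurableTypeR R]
      (fun x => (expR (- (2^-1 * (s * x ^+ 2)) + beta * x + c))%:E).
    by apply/measurable_EFinP; exact: measurable_expR_quadratic.
  apply: (@le_trans _ _ (\int[mu]_(x in D) (expR c)%:E)%E).
    by rewrite integral_cst// [X in (_ * X)%E]muD gt0_muley// lte_fin expR_gt0.
  apply: (@le_trans _ _ (\int[mu]_(x in D)
      (expR (- (2^-1 * (s * x ^+ 2)) + beta * x + c))%:E)%E).
    apply: ge0_le_integral => //.
    - exact: measurable_funTS.
    - move=> x Dx; rewrite lee_fin ler_expR lerDr addr_ge0 ?Db//.
      by rewrite -mulrN mulr_ge0// -mulNr mulr_ge0 ?oppr_ge0 ?sqr_ge0.
  exact: ge0_subset_integral.
have [b0|b0] := leP 0 beta.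
  apply: (ray `[0, +oo[%classic) => //; first by rewrite lebesgue_measure_itv/= ltry.
  by move=> x /=; rewrite in_itv/= andbT => x0; rewrite mulr_ge0.
apply: (ray `]-oo, 0]%classic) => //; first by rewrite lebesgue_measure_itv/= ltNyr.
by move=> x /=; rewrite in_itv/= => x0; rewrite mulr_le0// ltW.
Qed.

End gaussian_line.

Section gaussian_space.
Context (R : realType).

Definition quad n (Q : 'M[R]_n) (b : 'cV[R]_n) (c : R) (x : 'cV[R]_n) : R :=
  - (2^-1 * dotv x (Q *m x)) + dotv b x + c.

(** Eliminating the block [r] by a column operation exposes the Schur complement
of [Q]. *)
Lemma det_schur n (a : R) (r : 'cV[R]_n) (Q : 'M[R]_n) : Q \in unitmx ->
  \det (block_mx (a%:M : 'M[R]_1) r^T r Q) = (a - dotv r (invmx Q *m r)) * \det Q.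
Proof.
move=> uQ.
have E : block_mx (a%:M : 'M[R]_1) r^T r Q *m
    block_mx (1%:M : 'M[R]_1) 0 (- (invmx Q *m r)) 1%:M =
    block_mx ((a - dotv r (invmx Q *m r))%:M : 'M[R]_1) r^T 0 Q.
  rewrite mulmx_block !mulmx1 !mulmx0 !add0r !mulmxN mulKVmx// subrr.
  congr block_mx; apply/matrixP => i j; rewrite !ord1 !mxE !mulr1n.
  by congr (_ - _); rewrite /dotv mxE.
have := congr1 determinant E.
by rewrite det_mulmx det_lblock !det1 !mulr1 => ->; rewrite det_ublock det_scalar1.
Qed.

(** With the first coordinate [x] fixed, the exponent is again of the form [quad] in
the other coordinates: [x] only shifts the linear and constant terms. *)
Lemma quad_col n (a b0 c x : R) (r b y : 'cV[R]_n) (Q : 'M[R]_n) :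
  quad (block_mx (a%:M : 'M[R]_1) r^T r Q) (col_mx (b0%:M : 'M[R]_1) b) c
    (col_mx (x%:M : 'M[R]_1) y) =
  quad Q (b - x *: r) (- (2^-1 * (a * x ^+ 2)) + b0 * x + c) y.
Proof.
rewrite /quad mul_block_col.
have -> : a%:M *m x%:M + r^T *m y = (a * x + dotv r y)%:M :> 'M[R]_1.
  by rewrite [r^T *m y]mx11_scalar -scalar_mxM -raddfD.
rewrite mul_mx_scalar !dotv_col !dotvE (dotvC y r).
by field.
Qed.

Lemma invmx_mul_dot n (Q : 'M[R]_n) (b z : 'cV[R]_n) : Q \in unitmx ->
  Q *m z = b -> dotv b (invmx Q *m b) = dotv b z.
Proof. by move=> uQ <-; rewrite mulKmx. Qed.

(** [S z = B] is solved by a vector with first coordinate [beta / s], obtained by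
block elimination; pairing this solution with [B] gives the formula. *)
Lemma dot_schur n (a b0 : R) (r b : 'cV[R]_n) (Q : 'M[R]_n) : Q^T = Q ->
  Q \in unitmx ->
  let s := a - dotv r (invmx Q *m r) in
  let beta := b0 - dotv r (invmx Q *m b) in
  let S := block_mx (a%:M : 'M[R]_1) r^T r Q in
  let B := col_mx (b0%:M : 'M[R]_1) b in
  s != 0 ->
  dotv B (invmx S *m B) = dotv b (invmx Q *m b) + beta ^+ 2 / s.
Proof.
move=> QT uQ s beta S B s0.
have uS : S \in unitmx.
  by rewrite unitmxE det_schur// unitrM -unitmxE uQ andbT unitfE.
rewrite (@invmx_mul_dot _ _ _
  (col_mx ((beta / s)%:M : 'M[R]_1) (invmx Q *m (b - (beta / s) *: r))))//.
  rewrite dotv_col mulmxBr -scalemxAr !dotvE.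
  rewrite (@dotv_sym _ _ _ b r) ?trmx_inv ?QT// -/s.
  by rewrite /beta; field.
rewrite mul_block_col mulKVmx//; congr col_mx; last first.
  by rewrite mul_mx_scalar addrC subrK.
rewrite [r^T *m _]mx11_scalar -scalar_mxM -raddfD/=; congr (_%:M).
rewrite -/(dotv _ _) mulmxBr -scalemxAr !dotvE.
have -> : dotv r (invmx Q *m r) = a - s by rewrite /s; ring.
have -> : dotv r (invmx Q *m b) = b0 - beta by rewrite /beta; ring.
by field.
Qed.

(** Induction on the dimension. The inner integral, over all coordinates but the
first, either is infinite for every value of the first coordinate or leaves a
one-dimensional quadratic exponent whose leading coefficient is the Schur
complement [s]; the sign of [s] then decides. *)
Theorem integral_cV_gaussian n (Q : 'M[R]_n) : Q^T = Q ->
  (0 < \det Q /\ forall b c,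
     integral_cV (fun x => (expR (quad Q b c x))%:E) =
     (Num.sqrt ((2 * pi) ^+ n / \det Q) *
      expR (c + 2^-1 * dotv b (invmx Q *m b)))%:E) \/
  (forall b c, integral_cV (fun x => (expR (quad Q b c x))%:E) = +oo%E).
Proof.
elim: n Q => [|n IH] Q QT.
  left; rewrite det_mx00; split=> // b c.
  rewrite expr0 divr1 sqrtr1 mul1r /= /quad !(flatmx0 b) /dotv !flatmx0 !mulmx0.
  by rewrite !mxE mulr0 oppr0 !add0r addr0.
move: Q QT; rewrite -[n.+1]/(1 + n)%N => Q QT.
pose a := Q 0 0; pose r : 'cV[R]_n := dlsubmx Q; pose Q' : 'M[R]_n := drsubmx Q.
have QE : Q = block_mx (a%:M : 'M[R]_1) r^T r Q'.
  rewrite -[LHS]submxK; congr block_mx.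
    by apply/matrixP => i j; rewrite !ord1 !mxE mulr1n; congr (Q _ _); exact/val_inj.
  by rewrite /r trmx_dlsub QT.
have Q'T : Q'^T = Q' by rewrite /Q' trmx_drsub QT.
pose b0 (b : 'cV[R]_(1 + n)) := b 0 0.
pose b' (b : 'cV[R]_(1 + n)) : 'cV[R]_n := dsubmx b.
have bE b : b = col_mx ((b0 b)%:M : 'M[R]_1) (b' b).
  rewrite -[LHS]vsubmxK; congr col_mx.
  by apply/matrixP => i j; rewrite !ord1 !mxE mulr1n; congr (b _ _); exact/val_inj.
have inner b c : integral_cV (fun x : 'cV[R]_(1 + n) => (expR (quad Q b c x))%:E) =
   (\int[@lebesgue_measure R]_x integral_cV (fun y : 'cV[R]_n =>
     (expR (quad Q' (b' b - x *: r)
       (- (2^-1 * (a * x ^+ 2)) + b0 b * x + c) y))%:E))%E.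
  rewrite /=; apply: eq_integral => x _; apply: eq_integral_cV => y.
  by rewrite QE {1}(bE b) quad_col.
have [[dQ' fQ']|iQ'] := IH Q' Q'T; last first.
  right=> b c; rewrite inner; under eq_integral do rewrite iQ'.
  rewrite integral_cst// [X in (_ * X)%E](_ : _ = +oo%E) ?mulyy//.
  by rewrite -set_itvNyy; exact: lebesgue_measure_itv.
have uQ' : Q' \in unitmx by rewrite unitmxE unitfE gt_eqF.
pose s := a - dotv r (invmx Q' *m r).
have detQ : \det Q = s * \det Q' by rewrite QE det_schur.
have outer b c : integral_cV (fun x : 'cV[R]_(1 + n) => (expR (quad Q b c x))%:E) =
   ((Num.sqrt ((2 * pi) ^+ n / \det Q'))%:E *
    \int[@lebesgue_measure R]_x (expR (- (2^-1 * (s * x ^+ 2)) +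
      (b0 b - dotv r (invmx Q' *m b' b)) * x +
      (c + 2^-1 * dotv (b' b) (invmx Q' *m b' b))))%:E)%E.
  rewrite inner -ge0_integralZl_EFin ?sqrtr_ge0//.
  - apply: eq_integral => x _; rewrite fQ' EFinM; congr (_ * (expR _)%:E)%E.
    rewrite mulmxBr -scalemxAr !dotvE /s.
    rewrite (@dotv_sym _ _ _ (b' b) r) ?trmx_inv ?Q'T//; by field.
  - by apply/measurable_EFinP; exact: measurable_expR_quadratic.
have [s0|s0] := ltP 0 s; [left; split; first by rewrite detQ mulr_gt0|right] => b c.
  rewrite outer integral_expR_quadratic// -EFinM mulrA -sqrtrM; last first.
    apply: divr_ge0; last exact: ltW.
    by rewrite exprn_ge0// mulr_ge0// pi_ge0.
  congr (_ * _)%:E.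
    congr Num.sqrt; rewrite detQ add1n exprS; field.
    by rewrite !gt_eqF.
  congr expR; rewrite [in RHS](bE b) QE dot_schur ?gt_eqF//.
  by rewrite -addrA mulrDr.
rewrite outer integral_expR_quadratic_infty// gt0_muley// lte_fin sqrtr_gt0.
by rewrite divr_gt0// exprn_gt0// mulr_gt0// pi_gt0.
Qed.

End gaussian_space.
(** * Gaussian expectation of the exponential of a quadratic function *)

Definition qform (R : realType) n (V : 'M[R]_n) (v : 'cV[R]_n) (c : R)
    (x : 'cV[R]_n) : R :=
  c + dotv v x + 2^-1 * dotv x (V *m x).

(** The polynomial [r] such that averaging [exp (- sigma qform (y + z))] over a
centred Gaussian [z] of covariance [S] gives [exp (- sigma r(y))] up to a factor
independent of [y]. *)
Definition smoothed (R : realType) n (sigma : R) (S V : 'M[R]_n) (v : 'cV[R]_n)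
    (c : R) (y : 'cV[R]_n) : R :=
  qform V v c y - 2^-1 * (sigma *
    dotv (v + V *m y) (invmx (invmx S + sigma *: V) *m (v + V *m y))).

Section gaussian_law.
Context (R : realType).

Lemma quad_shift n (Q : 'M[R]_n) (b m x : 'cV[R]_n) (c : R) : Q^T = Q ->
  quad Q b c (x - m) =
  quad Q (b + Q *m m) (c - dotv b m - 2^-1 * dotv m (Q *m m)) x.
Proof.
move=> QT; rewrite /quad mulmxBr !dotvE (dotvC (Q *m m) x) (dotv_sym m x QT).
by field.
Qed.

(** Translating the variable does not change the value of the Gaussian integral. *)
Lemma quad_shift_value n (Q : 'M[R]_n) (b m : 'cV[R]_n) (c : R) : Q^T = Q ->
  Q \in unitmx ->
  c - dotv b m - 2^-1 * dotv m (Q *m m) +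
    2^-1 * dotv (b + Q *m m) (invmx Q *m (b + Q *m m)) =
  c + 2^-1 * dotv b (invmx Q *m b).
Proof.
move=> QT uQ; rewrite mulmxDr mulKmx// !dotvE (dotvC (Q *m m) m).
rewrite (@dotv_sym _ _ (invmx Q) (Q *m m) b) ?trmx_inv ?QT// mulKmx//.
by field.
Qed.

Lemma qform_quad n (sigma c : R) (S V : 'M[R]_n) (v y z : 'cV[R]_n) : V^T = V ->
  - sigma * qform V v c (y + z) - 2^-1 * dotv z (invmx S *m z) =
  quad (invmx S + sigma *: V) (- sigma *: (v + V *m y)) (- sigma * qform V v c y) z.
Proof.
move=> VT; rewrite /quad /qform mulmxDl mulmxDr -scalemxAl !dotvE.
rewrite (dotvC (V *m y) z) (dotv_sym y z VT); by field.
Qed.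

Lemma measurable_expR_quad n (Q : 'M[R]_n) (b : 'cV[R]_n) (c : R) :
  measurable_fun [set: 'cV[R]_n] (fun x => expR (quad Q b c x) : measurableTypeR R).
Proof.
apply: measurableT_comp => //; apply: measurable_funD; last exact: measurable_cst.
apply: measurable_funD.
  apply: measurable_funN; apply: measurable_funM; first exact: measurable_cst.
  apply: measurable_dotv; first exact: measurable_id.
  by apply: measurable_mulmx; exact: measurable_id.
by apply: measurable_dotv; [exact: measurable_cst|exact: measurable_id].
Qed.

Lemma gaussian_pdfE n (m x : 'cV[R]_n) (S : 'M[R]_n) :
  gaussian_pdf m S x = (Num.sqrt ((2 * pi) ^+ n * \det S))^-1 *
    expR (quad (invmx S) 0 0 (x - m)).
Proof.
by rewrite /gaussian_pdf /quad (dotvC 0) dotv0r !addr0.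
Qed.

Lemma gaussian_pdf_ge0 n (m x : 'cV[R]_n) (S : 'M[R]_n) : 0 <= gaussian_pdf m S x.
Proof. by rewrite mulr_ge0 ?expR_ge0// invr_ge0 sqrtr_ge0. Qed.

Lemma measurable_gaussian_pdf n (m : 'cV[R]_n) (S : 'M[R]_n) : S^T = S ->
  measurable_fun [set: 'cV[R]_n] (gaussian_pdf m S : _ -> measurableTypeR R).
Proof.
move=> ST; have -> : gaussian_pdf m S = fun x =>
    (Num.sqrt ((2 * pi) ^+ n * \det S))^-1 *
    expR (quad (invmx S) (0 + invmx S *m m)
      (0 - dotv 0 m - 2^-1 * dotv m (invmx S *m m)) x).
  by apply/funext => x; rewrite gaussian_pdfE quad_shift ?trmx_inv ?ST.
by apply: measurable_funM; [exact: measurable_cst|exact: measurable_expR_quad].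
Qed.

Context (d : measure_display) (Omega : measurableType d) (P : probability Omega R).

(** A nonpositive determinant would make the square root in the density vanish, hence
its inverse too, and the total mass would be 0. *)
Lemma gaussian_det_gt0 n (X : {RV P >-> 'cV[R]_n}) (m : 'cV[R]_n) (S : 'M[R]_n) :
  gaussian X m S -> 0 < \det S.
Proof.
move=> [_ law]; rewrite ltNge; apply/negP => detS.
have sqrt0 : Num.sqrt ((2 * pi) ^+ n * \det S) = 0.
  by apply/ler0_sqrtr/mulr_ge0_le0 => //; rewrite exprn_ge0// mulr_ge0// pi_ge0.
have := law setT measurableT; rewrite probability_setT.
rewrite (@eq_integral_cV _ _ _ (fun=> 0%E)) => [|x]; last first.
  by rewrite /gaussian_pdf sqrt0 invr0 mul0r mulr0.
by rewrite integral_cV0 => /eqP; rewrite onee_eq0.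
Qed.

(** The density and the quadratic function combine into one quadratic exponent with
matrix [S^-1 + sigma V], and [(S^-1 + sigma V) S = 1 + sigma V S]. *)
Lemma integral_gaussian_qform n (X : {RV P >-> 'cV[R]_n}) (m : 'cV[R]_n)
    (S V : 'M[R]_n) (v : 'cV[R]_n) (sigma c : R) :
  gaussian X m S -> V^T = V ->
  (0 < \det (1%:M + sigma *: (V *m S)) /\ forall y,
    (\int[distribution P X]_w (expR (- sigma * qform V v c (y + (w - m))))%:E =
     ((Num.sqrt (\det (1%:M + sigma *: (V *m S))))^-1 *
      expR (- sigma * smoothed sigma S V v c y))%:E)%E) \/
  (forall y,
    \int[distribution P X]_w (expR (- sigma * qform V v c (y + (w - m))))%:E = +oo)%E.
Proof.
move=> gX VT; have detS := gaussian_det_gt0 gX.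
have uS : S \in unitmx by rewrite unitmxE unitfE gt_eqF.
have [[ST _] law] := gX.
pose Q := invmx S + sigma *: V.
have QT : Q^T = Q by rewrite /Q linearD/= linearZ/= trmx_inv ST VT.
have QS : Q *m S = 1%:M + sigma *: (V *m S).
  by rewrite mulmxDl mulVmx// -scalemxAl.
pose k := (Num.sqrt ((2 * pi) ^+ n * \det S))^-1.
have pin : 0 < (2 * pi) ^+ n :> R by rewrite exprn_gt0// mulr_gt0// pi_gt0.
have k0 : 0 < k by rewrite invr_gt0 sqrtr_gt0 mulr_gt0.
pose b y := - sigma *: (v + V *m y).
have E y : (\int[distribution P X]_w (expR (- sigma * qform V v c (y + (w - m))))%:E =
    k%:E * integral_cV (fun x => (expR (quad Q (b y + Q *m m)
      (- sigma * qform V v c y - dotv (b y) m - 2^-1 * dotv m (Q *m m)) x))%:E))%E.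
  rewrite (integral_density (p := gaussian_pdf m S)).
  - rewrite -integral_cVZl ?(ltW k0)//.
    + apply: eq_integral_cV => x; rewrite gaussian_pdfE -/k -!EFinM; congr EFin.
      rewrite mulrCA -expRD; congr (_ * expR _).
      rewrite -quad_shift// -qform_quad//; congr (_ + _).
      by rewrite /quad (dotvC 0) dotv0r !addr0.
    + by apply/measurable_EFinP; exact: measurable_expR_quad.
  - exact: measurable_gaussian_pdf.
  - by move=> x; exact: gaussian_pdf_ge0.
  - exact: law.
  - apply/measurable_EFinP; apply: measurableT_comp => //.
    apply: measurable_funM; first exact: measurable_cst.
    have my : measurable_fun [set: 'cV[R]_n] (fun w => y + (w - m)).
      apply: measurable_addmx; first exact: measurable_cst.
      by apply: measurable_addmx; [exact: measurable_id|exact: measurable_cst].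
    apply: measurable_funD.
      apply: measurable_funD; first exact: measurable_cst.
      by apply: measurable_dotv => //; exact: measurable_cst.
    apply: measurable_funM; first exact: measurable_cst.
    by apply: measurable_dotv => //; exact: measurable_mulmx.
  - by move=> x; rewrite lee_fin expR_ge0.
have [[detQ fQ]|iQ] := integral_cV_gaussian QT; [left|right] => [|y]; last first.
  by rewrite E iQ gt0_muley// lte_fin.
rewrite -QS det_mulmx; split=> [|y]; first by rewrite mulr_gt0.
have uQ : Q \in unitmx by rewrite unitmxE unitfE gt_eqF.
rewrite E fQ quad_shift_value// -EFinM mulrA; congr (_ * expR _)%:E.
  rewrite /k -sqrtrV; last by rewrite mulr_ge0// ltW.
  rewrite -sqrtrM; last by rewrite invr_ge0 mulr_ge0// ltW.
  rewrite -sqrtrV; last by rewrite mulr_ge0// ltW.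
  congr Num.sqrt; field.
  by rewrite !gt_eqF.
rewrite /smoothed /b -scalemxAr !dotvE -/Q; by field.
Qed.

End gaussian_law.

(** * The smoothed quadratic in terms of M and N *)

Section recursion.
Context (R : realType) (n : nat).
Variables (sigma : R) (S V : 'M[R]_n) (v : 'cV[R]_n) (c : R).
Hypotheses (sigma0 : sigma != 0) (VT : V^T = V) (ST : S^T = S)
  (uS : S \in unitmx) (detVS : \det (1%:M + sigma *: (V *m S)) != 0).

Let Q := invmx S + sigma *: V.

Lemma unit_precision : Q \in unitmx.
Proof.
have QS : Q *m S = 1%:M + sigma *: (V *m S).
  by rewrite mulmxDl mulVmx// -scalemxAl.
rewrite unitmxE unitfE; apply: contraNneq detVS => Q0.
by rewrite -QS det_mulmx Q0 mul0r.
Qed.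

Lemma smoothed_at0 : smoothed sigma S V v c 0 =
  c - 2^-1 * dotv v (invmx (V + sigma^-1 *: invmx S) *m v).
Proof.
have -> : V + sigma^-1 *: invmx S = sigma^-1 *: Q.
  by rewrite scalerDr scalerA mulVf// scale1r addrC.
have uQ := unit_precision.
rewrite invmxZ ?unitmxZ ?unitfE ?invr_eq0// invrK.
rewrite /smoothed /qform !mulmx0 !dotv0r addr0 mulr0 !addr0 -scalemxAl dotvZr.
by rewrite -/Q.
Qed.

Hypothesis uV : V \in unitmx.
Let M := invmx (sigma *: S + invmx V).
Let N := v - sigma *: (M *m S *m v).

Let unit_M : sigma *: S + invmx V \in unitmx.
Proof.
have uQ := unit_precision.
have : (sigma *: S + invmx V) *m V \in unitmx.
  have -> : (sigma *: S + invmx V) *m V = S *m Q.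
    by rewrite mulmxDl mulVmx// mulmxDr mulmxV// -scalemxAl -scalemxAr addrC.
  by rewrite unitmx_mul uS.
by rewrite unitmx_mul => /andP[].
Qed.

(* Multiply by [sigma S + V^-1] on the left and by [Q] on the right. *)
Let MS : V *m invmx Q = M *m S.
Proof.
have uQ := unit_precision.
apply: (canRL (mulKmx unit_M)); rewrite mulmxA; apply: (canLR (mulmxK uQ)).
by rewrite mulmxDl mulVmx// mulmxDr mulmxV// -scalemxAl -scalemxAr addrC.
Qed.

Let ME : V - sigma *: (V *m invmx Q *m V) = M.
Proof.
rewrite MS -[RHS]mulmx1 -!mulmxA; apply: (canRL (mulKmx unit_M)).
rewrite mulmxBr -scalemxAr mulKVmx//.
by rewrite mulmxDl mulVmx// -scalemxAl addrAC subrr add0r.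
Qed.

Lemma smoothedE y : smoothed sigma S V v c y =
  c - 2^-1 * dotv v (invmx (V + sigma^-1 *: invmx S) *m v) +
  dotv N y + 2^-1 * dotv y (M *m y).
Proof.
rewrite -smoothed_at0 /smoothed /qform !mulmx0 !dotv0r addr0 mulr0 !addr0.
have iQT : (invmx Q)^T = invmx Q by rewrite trmx_inv /Q linearD/= linearZ/= trmx_inv ST VT.
rewrite -ME mulmxBl -scalemxAl /N -MS !mulmxDr -/Q !dotvE.
rewrite (dotvC (V *m invmx Q *m v)) -!mulmxA.
rewrite (dotv_sym v (V *m y) iQT) (dotvC (V *m y) (invmx Q *m v)).
rewrite (dotv_sym y (invmx Q *m v) VT) (dotv_sym y (invmx Q *m (V *m y)) VT).
rewrite (dotvC (invmx Q *m (V *m y)) (V *m y)).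
by field.
Qed.

End recursion.
(** * Conditioning on the past *)

Lemma integral_probability_cst (d : measure_display) (Omega : measurableType d)
    (R : realType) (P : probability Omega R) (c : \bar R) :
  (\int[P]_om c = c)%E.
Proof.
rewrite integral_cst// -[RHS]mule1; congr (_ * _)%E; exact: probability_setT.
Qed.

Section independence.
Context (d : measure_display) (Omega : measurableType d) (R : realType).
Variables (P : probability Omega R) (n N : nat).
Variable X : 'I_N -> {RV P >-> 'cV[R]_n}.
Hypothesis indepX : mutually_independent X.

(** Events depending on the variables of index less than [k] through a product of
measurable sets: a pi-system generating the sigma-algebra of the past. *)
Definition past (k : nat) : set (set Omega) :=
  [set A | exists B : 'I_N -> set 'cV[R]_n,
    [/\ forall i, measurable (B i),
        forall i : 'I_N, (k <= i)%N -> B i = setT &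
        A = \bigcap_(i in [set: 'I_N]) (X i @^-1` B i)]].

Lemma past_measurable k : past k `<=` measurable.
Proof.
move=> A [B [mB _ ->]]; apply: fin_bigcap_measurable => [|i _].
  exact: finite_finset.
by rewrite -[_ @^-1` _]setTI; exact: measurable_funP.
Qed.

Lemma past_setT k : past k setT.
Proof. by exists (fun=> setT); split=> //; apply/esym; rewrite -subTset => om _ i. Qed.

Lemma past_setI k : setI_closed (past k).
Proof.
move=> _ _ [B [mB TB ->]] [C [mC TC ->]].
exists (fun i => B i `&` C i); split.
- by move=> i; exact: measurableI.
- by move=> i ki; rewrite TB// TC// setTI.
- by rewrite -bigcapI; apply: eq_bigcapr => i _; rewrite preimage_setI.
Qed.

Lemma past_coord (k : nat) (i : 'I_N) : (i < k)%N ->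
  measurable_fun [set: g_sigma_algebraType (past k)] (X i : _ -> 'cV[R]_n).
Proof.
move=> ik _ C mC; rewrite setTI; apply: sub_sigma_algebra.
exists (fun j => if j == i then C else setT); split.
- by move=> j; case: ifP.
- by move=> j; case: eqP => // ->; rewrite leqNgt ik.
- apply/seteqP; split=> [om Com j _ /=|om /(_ i I)/=]; last by rewrite eqxx.
  by case: eqP => // ->.
Qed.

(** Both sides are finite measures in [A] which agree on the pi-system [past k] by
the product rule. *)
Lemma past_independent (k : 'I_N) (A : set Omega) (C : set 'cV[R]_n) :
  <<s past k >> A -> measurable C ->
  P (A `&` X k @^-1` C) = (P A * P (X k @^-1` C))%E.
Proof.
move=> sA mC.
have mD : measurable (X k @^-1` C).
  by rewrite -[_ @^-1` _]setTI; exact: measurable_funP.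
pose D := X k @^-1` C.
have PD0 : 0 <= fine (P D) by exact/fine_ge0/measure_ge0.
suff : mrestr P mD A = mscale (NngNum PD0) P A.
  by rewrite /mrestr /mscale/= => ->; rewrite fineK ?fin_num_measure// muleC.
apply: (g_sigma_algebra_measure_unique (past k) _ (fun=> setT)) => //.
- exact: past_measurable.
- by move=> _; exact: past_setT.
- by rewrite -subTset => om _; exists 0%N.
- exact: past_setI.
- move=> _ [B [mB TB ->]].
  change (P (\bigcap_(i in [set: 'I_N]) (X i @^-1` B i) `&` D) =
    (fine (P D))%:E * P (\bigcap_(i in [set: 'I_N]) (X i @^-1` B i)))%E.
  rewrite fineK ?fin_num_measure//.
  pose B' i := if i == k then C else B i.
  have mB' i : measurable (B' i) by rewrite /B'; case: ifP.
  have -> : \bigcap_(i in [set: 'I_N]) (X i @^-1` B i) `&` X k @^-1` C =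
      \bigcap_(i in [set: 'I_N]) (X i @^-1` B' i).
    apply/seteqP; split=> [om [Bom Com] j _ /=|om B'om].
      by rewrite /B'; case: eqP => [->//|_]; exact: Bom.
    split=> [j _ /=|]; last by have := B'om k I; rewrite /B'/= eqxx.
    have := B'om j I; rewrite /B'/=; case: eqP => // -> _.
    by rewrite TB.
  rewrite !indepX// (bigD1 k)//= [in RHS](bigD1 k)//= /B' eqxx TB//.
  rewrite preimage_setT probability_setT mul1e; congr (_ * _)%E.
  by apply: eq_bigr => i /negbTE ->.
- move=> _; change (P (setT `&` D) < +oo)%E; rewrite setTI.
  exact: (le_lt_trans (probability_le1 P mD) (ltry _)).
Qed.

Lemma measurable_past (d' : measure_display) (U : measurableType d') (k : nat)
    (h : Omega -> U) :
  measurable_fun [set: g_sigma_algebraType (past k)] (h : _ -> U) ->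
  measurable_fun [set: Omega] h.
Proof.
move=> mh _ A mA; have := mh measurableT A mA; rewrite !setTI.
by apply: smallest_sub; [exact: sigma_algebra_measurable|exact: past_measurable].
Qed.

(** By [past_independent], the identity map into the sigma-algebra of the past and
[X k] are independent, so their joint law is a product measure and Tonelli's
theorem applies. *)
Lemma integral_past (k : 'I_N)
    (h : g_sigma_algebraType (past k) -> 'cV[R]_n -> \bar R) :
  measurable_fun [set: g_sigma_algebraType (past k) * 'cV[R]_n]
    (fun z => h z.1 z.2) ->
  (forall om x, 0 <= h om x)%E ->
  (\int[P]_om h om (X k om) =
   \int[P]_om \int[distribution P (X k)]_x h om x)%E.
Proof.
move=> mh h0.
have mid : measurable_fun [set: Omega] (id : Omega -> g_sigma_algebraType (past k)).
  by apply: (measurable_past (k := k)); exact: measurable_id.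
pose past_id : {mfun Omega >-> g_sigma_algebraType (past k)} :=
  HB.pack (id : Omega -> g_sigma_algebraType (past k))
    (isMeasurableFun.Build _ _ _ _ _ mid).
pose Q := distribution P past_id.
pose phi om : g_sigma_algebraType (past k) * 'cV[R]_n := (om, X k om).
have mphi : measurable_fun setT phi by exact: measurable_fun_pair.
have prod E : measurable E ->
    (Q \x distribution P (X k))%E E = pushforward P phi E.
  apply: product_measure_unique => A C mA mC.
  by rewrite [LHS]past_independent.
transitivity (\int[pushforward P phi]_z h z.1 z.2)%E.
  by rewrite ge0_integral_pushforward.
transitivity (\int[(Q \x distribution P (X k))%E]_z h z.1 z.2)%E.
  by apply: eq_measure_integral => E mE _; exact/esym/prod.
rewrite fubini_tonelli1// /fubini_F ge0_integral_pushforward//.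
- exact: (measurable_fun_fubini_tonelli_F (m2 := distribution P (X k)) (fun z => h z.1 z.2)).
- by move=> om _; exact: integral_ge0.
Qed.

End independence.
(** * Backward evaluation of the expected exponential cost *)

Section risk_sensitive_cost.
Context (d : measure_display) (Omega : measurableType d) (R : realType).
Context (P : probability Omega R) (n T : nat) (sigma : R).
Variables (X : nat -> {RV P >-> 'cV[R]_n}) (mean : nat -> 'cV[R]_n).
Variable S : nat -> 'M[R]_n.
Hypothesis indepX : mutually_independent (fun i : 'I_T.+1 => X i).
Hypothesis gaussX : forall t, (t <= T)%N -> gaussian (X t) (mean t) (S t).
Variables (F : nat -> 'M[R]_n) (g : nat -> 'cV[R]_n).
Variables (lxx : nat -> 'M[R]_n) (lx : nat -> 'cV[R]_n) (lbar : nat -> R).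
Variable dx : nat -> Omega -> 'cV[R]_n.
Hypothesis dx0 : forall om, dx 0 om = X 0 om - mean 0.
Hypothesis dxS : forall t, (t < T)%N -> forall om,
  dx t.+1 om = F t *m dx t om + g t.+1 + (X t.+1 om - mean t.+1).
Variables (V : nat -> 'M[R]_n) (v : nat -> 'cV[R]_n) (vbar : nat -> R).
Hypothesis symV : forall t, (t <= T)%N -> (V t)^T = V t.
Hypothesis value_T : forall x,
  qform (V T) (v T) (vbar T) x = qform (lxx T) (lx T) (lbar T) x.

Let D t := \det (1%:M + sigma *: (V t *m S t)).

Hypothesis bellman : forall t, (t < T)%N -> 0 < D t.+1 -> forall x,
  qform (V t) (v t) (vbar t) x = qform (lxx t) (lx t) (lbar t) x +
  smoothed sigma (S t.+1) (V t.+1) (v t.+1) (vbar t.+1) (F t *m x + g t.+1).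

(* The part of [dx k] that is determined by the noises of index less than [k]. *)
Let predicted k om := if k is t.+1 then F t *m dx t om + g t.+1 else 0.

Let cost k om := \sum_(0 <= t < k) qform (lxx t) (lx t) (lbar t) (dx t om).

Let dxE k om : (k <= T)%N -> dx k om = predicted k om + (X k om - mean k).
Proof. by case: k => [_|t tT]; rewrite ?dx0 ?add0r// dxS. Qed.

Lemma measurable_past_dx (k : nat) : (k <= T.+1)%N -> forall t, (t < k)%N ->
  measurable_fun [set: g_sigma_algebraType (past (fun i : 'I_T.+1 => X i) k)]
    (dx t : _ -> 'cV[R]_n).
Proof.
move=> kT; elim=> [|t IH] tk.
  rewrite (_ : dx 0%N = fun om => X 0%N om + - mean 0%N); last by apply/funext.
  apply: measurable_addmx; last exact: measurable_cst.
  exact: (@past_coord _ _ _ _ _ _ (fun i : 'I_T.+1 => X i) k (Ordinal (leq_trans tk kT))).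
have tT : (t.+1 < T.+1)%N by exact: leq_trans kT.
have -> : dx t.+1 = fun om =>
    F t *m dx t om + g t.+1 + (X t.+1 om + - mean t.+1).
  by apply/funext => om; rewrite dxS.
apply: measurable_addmx.
  apply: measurable_addmx; last exact: measurable_cst.
  by apply: measurable_mulmx; apply: IH; exact: ltnW.
apply: measurable_addmx; last exact: measurable_cst.
exact: (@past_coord _ _ _ _ _ _ (fun i : 'I_T.+1 => X i) k (Ordinal tT)).
Qed.

Lemma measurable_qform (d' : measure_display) (U : measurableType d')
    (W : 'M[R]_n) (b : 'cV[R]_n) (c : R) (h : U -> 'cV[R]_n) :
  measurable_fun setT h ->
  measurable_fun setT (fun t => qform W b c (h t) : measurableTypeR R).
Proof.
move=> mh; apply: measurable_funD.
  apply: measurable_funD; first exact: measurable_cst.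
  by apply: measurable_dotv => //; exact: measurable_cst.
apply: measurable_funM; first exact: measurable_cst.
by apply: measurable_dotv => //; exact: measurable_mulmx.
Qed.

Lemma measurable_past_predicted (k : nat) : (k <= T)%N ->
  measurable_fun [set: g_sigma_algebraType (past (fun i : 'I_T.+1 => X i) k)]
    (predicted k : _ -> 'cV[R]_n).
Proof.
case: k => [_|t tT]; first exact: measurable_cst.
apply: measurable_addmx; last exact: measurable_cst.
by apply: measurable_mulmx; apply: measurable_past_dx => //; exact: leqW.
Qed.

Lemma measurable_past_cost (k : nat) : (k <= T)%N ->
  measurable_fun [set: g_sigma_algebraType (past (fun i : 'I_T.+1 => X i) k)]
    (cost k : _ -> measurableTypeR R).
Proof.
move=> kT.
have -> : cost k = fun om => \sum_(t < k) qform (lxx t) (lx t) (lbar t) (dx t om).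
  by apply/funext => om; rewrite /cost big_mkord.
apply: measurable_sum => t; apply: measurable_qform.
by apply: measurable_past_dx => //; exact: leqW.
Qed.

(* The stages from [k] on are replaced by the quadratic value function of time
   [k]. *)
Let expected k := (\int[P]_om (expR (- sigma * cost k om) *
  expR (- sigma * qform (V k) (v k) (vbar k) (dx k om)))%:E)%E.

(** Integrates out the noise of index [k]. If its Gaussian integral were infinite,
it would be so for every past, and the expectation itself would be infinite. *)
Lemma expected_step k : (k <= T)%N -> (expected k < +oo)%E ->
  0 < D k /\
  expected k = (\int[P]_om ((Num.sqrt (D k))^-1 * (expR (- sigma * cost k om) *
    expR (- sigma * smoothed sigma (S k) (V k) (v k) (vbar k) (predicted k om))))%:E)%E.
Proof.
move=> kT fin.
have kT' : (k < T.+1)%N by [].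
pose h om w := (expR (- sigma * cost k om) * expR (- sigma *
  qform (V k) (v k) (vbar k) (predicted k om + (w - mean k))))%:E.
have E : expected k = (\int[P]_om \int[distribution P (X k)]_w h om w)%E.
  rewrite -(integral_past indepX (k := Ordinal kT') (h := h)).
  - by apply: eq_integral => om _; rewrite /h /= dxE.
  - apply/measurable_EFinP; apply: measurable_funM; apply: measurableT_comp => //.
      apply: measurable_funM; first exact: measurable_cst.
      by apply: (measurableT_comp (measurable_past_cost kT)); exact: measurable_fst.
    apply: measurable_funM; first exact: measurable_cst.
    apply: measurable_qform; apply: measurable_addmx.
      by apply: (measurableT_comp (measurable_past_predicted kT)); exact: measurable_fst.
    by apply: measurable_addmx; [exact: measurable_snd|exact: measurable_cst].
  - by move=> om w; rewrite lee_fin mulr_ge0 ?expR_ge0.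
have inner om : (\int[distribution P (X k)]_w h om w =
    (expR (- sigma * cost k om))%:E * \int[distribution P (X k)]_w
      (expR (- sigma * qform (V k) (v k) (vbar k) (predicted k om + (w - mean k))))%:E)%E.
  rewrite -ge0_integralZl_EFin ?expR_ge0//.
  apply/measurable_EFinP; apply: measurableT_comp => //.
  apply: measurable_funM; first exact: measurable_cst.
  apply: measurable_qform; apply: measurable_addmx; first exact: measurable_cst.
  by apply: measurable_addmx; [exact: measurable_id|exact: measurable_cst].
have [[Dk value]|infinite] :=
    integral_gaussian_qform (v k) sigma (vbar k) (gaussX kT) (symV kT).
  split=> //; rewrite E; apply: eq_integral => om _.
  by rewrite inner value -EFinM mulrCA.
move: fin; rewrite E (@eq_integral _ _ _ _ _ (fun=> +oo%E)) => [|om _].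
  by rewrite integral_probability_cst ltxx.
by rewrite inner infinite gt0_muley// lte_fin expR_gt0.
Qed.

(** Each step down from [k + 1] to [k] extracts one determinant, and [bellman] merges
the smoothed value function with the stage cost of time [k]. *)
Lemma expected_backward j : (j <= T)%N -> (expected T < +oo)%E ->
  [/\ (forall t, (T - j < t <= T)%N -> 0 < D t), (expected (T - j) < +oo)%E &
   expected T = ((\prod_((T - j).+1 <= t < T.+1) Num.sqrt (D t))^-1%:E *
     expected (T - j))%E].
Proof.
move=> jT fin; elim: j jT => [_|j IH jT].
  rewrite subn0 big_geq// invr1 mul1e; split=> // t /andP[tT].
  by rewrite leqNgt tT.
have [posD finj eqT] := IH (ltnW jT).
set k := (T - j.+1)%N.
have kE : (T - j)%N = k.+1 by rewrite subnSK.
rewrite kE in posD finj eqT.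
have kT : (k < T)%N by rewrite -kE leq_subr.
have [Dk Ek] := expected_step kT finj.
have {}Ek : expected k.+1 = ((Num.sqrt (D k.+1))^-1%:E * expected k)%E.
  pose later om := smoothed sigma (S k.+1) (V k.+1) (v k.+1) (vbar k.+1)
    (predicted k.+1 om).
  have bell om : qform (V k) (v k) (vbar k) (dx k om) =
      qform (lxx k) (lx k) (lbar k) (dx k om) + later om.
    exact: bellman.
  have costS om : cost k.+1 om =
      cost k om + qform (lxx k) (lx k) (lbar k) (dx k om).
    by rewrite /cost big_nat_recr.
  rewrite {}Ek.
  transitivity (\int[P]_om ((Num.sqrt (D k.+1))^-1%:E * (expR (- sigma * cost k om) *
      expR (- sigma * qform (V k) (v k) (vbar k) (dx k om)))%:E))%E.
    apply: eq_integral => om _; rewrite -EFinM; congr ((_ * _)%:E).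
    rewrite costS bell -/(later om) -!expRD; congr expR; ring.
  apply: ge0_integralZl_EFin; last by rewrite invr_ge0 sqrtr_ge0.
  - exact: measurableT.
  - by move=> om _; rewrite lee_fin mulr_ge0 ?expR_ge0.
  - apply/measurable_EFinP; apply: measurable_funM; apply: measurableT_comp => //.
      apply: measurable_funM; first exact: measurable_cst.
      apply: (measurable_past (k := k)); apply: measurable_past_cost.
      exact: ltnW.
    apply: measurable_funM; first exact: measurable_cst.
    apply: measurable_qform; apply: (measurable_past (k := k.+1)).
    by apply: measurable_past_dx => //; exact: ltnW.
have sD : 0 < (Num.sqrt (D k.+1))^-1 by rewrite invr_gt0 sqrtr_gt0.
split.
- move=> t /andP[]; rewrite leq_eqVlt => /predU1P[<- _//|kt tT].
  by apply: posD; rewrite kt.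
- rewrite ltey; apply/eqP => kinf; move: finj.
  by rewrite Ek kinf gt0_muley ?lte_fin// ltxx.
- rewrite eqT Ek muleA -EFinM; congr (_%:E * _)%E.
  by rewrite [in RHS]big_ltn// invfM mulrC.
Qed.

Theorem expected_cost :
  (\int[P]_om (expR (- sigma * cost T.+1 om))%:E < +oo)%E ->
  (forall t, (t <= T)%N -> 0 < D t) /\
  (\int[P]_om (expR (- sigma * cost T.+1 om))%:E =
   ((\prod_(0 <= t < T.+1) Num.sqrt (D t))^-1 *
     expR (- sigma * smoothed sigma (S 0) (V 0) (v 0) (vbar 0) 0))%:E)%E.
Proof.
have -> : (\int[P]_om (expR (- sigma * cost T.+1 om))%:E = expected T)%E.
  apply: eq_integral => om _; rewrite -expRD -mulrDr value_T.
  by rewrite /cost big_nat_recr.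
move=> fin; have [posD fin0 ->] := expected_backward (leqnn T) fin.
rewrite subnn in posD fin0 *.
have [D0 ->] := expected_step (leq0n T) fin0.
split=> [[//|t] tT|]; first by apply: posD.
under eq_integral do rewrite /cost big_geq// mulr0 expR0 mul1r /=.
rewrite integral_probability_cst -EFinM; congr EFin.
by rewrite [in RHS]big_ltn// invfM mulrA; congr (_ * _); rewrite mulrC.
Qed.

End risk_sensitive_cost.
(** * Symmetry of the Hessian *)

Section second_derivatives.
Context (R : realType) (V : normedModType R).

Lemma is_derive_line (g : V -> R) (x a : V) (s : R) :
  derivable g (x + s *: a) a ->
  is_derive s 1 (fun r : R => g (x + r *: a)) (derive g (x + s *: a) a).
Proof.
move=> dg.
have E : (fun h : R => h^-1 *: (((fun r : R => g (x + r *: a)) \o shift s) (h *: 1)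
       - g (x + s *: a)))
   = (fun h : R => h^-1 *: ((g \o shift (x + s *: a)) (h *: a) - g (x + s *: a))).
  by apply/funext => h /=; rewrite [h *: 1]mulr1 scalerDl addrCA.
split; first by rewrite /derivable E.
by rewrite /derive E.
Qed.

Lemma MVT_line (g : V -> R) (x a : V) (h : R) : 0 < h ->
  (forall y, derivable g y a) ->
  exists2 s : R, 0 <= s <= h & g (x + h *: a) - g x = h * derive g (x + s *: a) a.
Proof.
move=> h0 dg.
have dl (s : R) : is_derive s 1 (fun r : R => g (x + r *: a)) (derive g (x + s *: a) a).
  exact: is_derive_line.
have [|s] := @MVT R _ _ 0 h h0 (fun s _ => dl s).
  apply: continuous_subspaceT => s.
  apply: differentiable_continuous; apply/derivable1_diffP.
  by have [] := dl s.
rewrite in_itv/= => /andP[s0 sh] E; exists s; first by rewrite !ltW.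
by move: E; rewrite scale0r addr0 subr0 mulrC.
Qed.

(** Two applications of the mean value theorem to the second difference of [g] over
the parallelogram spanned by [h a] and [h b]. *)
Lemma MVT_square (g : V -> R) (x a b : V) (h : R) : 0 < h ->
  (forall y, derivable g y a) ->
  (forall y, derivable (fun z => derive g z a) y b) ->
  exists s t : R, [/\ 0 <= s <= h, 0 <= t <= h &
    g (x + h *: a + h *: b) - g (x + h *: a) - g (x + h *: b) + g x =
    h ^+ 2 * derive (fun z => derive g z a) (x + s *: a + t *: b) b].
Proof.
move=> h0 dga dgab.
have dsh y : derivable (fun z => g (z + h *: b)) y a /\
    derive (fun z => g (z + h *: b)) y a = derive g (y + h *: b) a.
  have E : (fun k : R => k^-1 *: (((fun z => g (z + h *: b)) \o shift y) (k *: a)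
       - g (y + h *: b)))
   = (fun k : R => k^-1 *: ((g \o shift (y + h *: b)) (k *: a) - g (y + h *: b))).
    by apply/funext => k /=; rewrite addrA.
  split; last by rewrite /derive E.
  by rewrite /derivable E; exact: dga.
pose G y := g (y + h *: b) - g y.
have dG y : derivable G y a.
  by apply: derivableB; [have [] := dsh y|exact: dga].
have [s sh Es] := MVT_line x h0 dG.
have [t th Et] := MVT_line (x + s *: a) h0 dgab.
exists s, t; split=> //.
transitivity (G (x + h *: a) - G x); first by rewrite /G; ring.
rewrite Es deriveB; [|by have [] := dsh (x + s *: a)|exact: dga].
by rewrite (dsh _).2 Et expr2 mulrA.
Qed.

Lemma continuous_square_lt (G : V -> R) (x a b : V) (e : R) : 0 < e ->
  {for x, continuous G} -> exists2 h0 : R, 0 < h0 &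
  forall s t : R, 0 <= s <= h0 -> 0 <= t <= h0 ->
    `|G (x + s *: a + t *: b) - G x| < e.
Proof.
move=> e0 cG.
have /cvgrPdist_lt/(_ e e0)/nbhs_ballP[d /= d0 Hd] := cG.
pose K := `|a| + `|b| + 1.
have K0 : 0 < K by rewrite ltr_wpDl// addr_ge0.
exists (d / (K *+ 2)) => [|s t /andP[s0 sh] /andP[t0 th]].
  by rewrite divr_gt0// pmulrn_lgt0.
rewrite distrC; apply: Hd; rewrite -ball_normE /=.
rewrite opprD addrA opprD addrA subrr add0r -opprD normrN.
apply: (@le_lt_trans _ _ (s * `|a| + t * `|b|)).
  by rewrite (le_trans (ler_normD _ _))// !normrZ !ger0_norm.
apply: (@le_lt_trans _ _ (d / (K *+ 2) * (`|a| + `|b|))).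
  by rewrite mulrDr lerD// ler_wpM2r.
rewrite mulrAC ltr_pdivrMr ?pmulrn_lgt0// ltr_pM2l//.
rewrite /K; have := normr_ge0 a; have := normr_ge0 b; lra.
Qed.

Lemma not_close_to_both (A B C : R) :
  `|C - A| < `|A - B| / 2 -> `|C - B| < `|A - B| / 2 -> False.
Proof.
move=> H1 H2; have : `|A - B| < `|A - B| / 2 + `|A - B| / 2.
  rewrite -{1}(subrK C A) -addrA (le_lt_trans (ler_normD _ _))//.
  by rewrite distrC ltrD.
by rewrite -splitr ltxx.
Qed.

(** The second difference is symmetric in [a] and [b], so [MVT_square] produces equal
values of the two mixed derivatives at points arbitrarily close to [x]. *)
Theorem derive_comm (g : V -> R) (x a b : V) :
  (forall y, derivable g y a) -> (forall y, derivable g y b) ->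
  (forall y, derivable (fun z => derive g z a) y b) ->
  (forall y, derivable (fun z => derive g z b) y a) ->
  {for x, continuous (fun y => derive (fun z => derive g z a) y b)} ->
  {for x, continuous (fun y => derive (fun z => derive g z b) y a)} ->
  derive (fun z => derive g z a) x b = derive (fun z => derive g z b) x a.
Proof.
move=> da db dab dba cab cba; apply/eqP/negPn/negP => neq.
set A := derive _ x b in cab neq *; set B := derive _ x a in cba neq *.
have e0 : 0 < `|A - B| / 2 by rewrite divr_gt0// normr_gt0 subr_eq0.
have [h1 h10 H1] := continuous_square_lt a b e0 cab.
have [h2 h20 H2] := continuous_square_lt b a e0 cba.
pose h := Num.min h1 h2.
have h0 : 0 < h by rewrite lt_min h10.
have [s [t [/andP[s0 sh] /andP[t0 th] E1]]] := MVT_square x h0 da dab.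
have [s' [t' [/andP[s'0 s'h] /andP[t'0 t'h] E2]]] := MVT_square x h0 db dba.
have hh1 : h <= h1 by rewrite ge_min lexx.
have hh2 : h <= h2 by rewrite ge_min lexx orbT.
have {}H1 := H1 s t; have {}H2 := H2 s' t'.
rewrite s0 (le_trans sh hh1) t0 (le_trans th hh1) in H1.
rewrite s'0 (le_trans s'h hh2) t'0 (le_trans t'h hh2) in H2.
have {H1} := H1 isT isT; have {H2} := H2 isT isT.
have -> : derive (fun z => derive g z a) (x + s *: a + t *: b) b =
  derive (fun z => derive g z b) (x + s' *: b + t' *: a) a.
  apply: (@mulfI _ (h ^+ 2)); first by rewrite expf_neq0// gt_eqF.
  have swap : x + h *: b + h *: a = x + h *: a + h *: b by rewrite addrAC.
  apply: etrans (esym E1) (etrans _ E2).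
  by rewrite swap; congr (_ + _); exact: addrAC.
by move=> H2 H1; exact: not_close_to_both H1 H2.
Qed.

End second_derivatives.

Lemma hessian_sym (R : realType) (n : nat) (g : 'cV[R]_n -> R) (x : 'cV[R]_n) :
  classC2 g -> (hessian g x)^T = hessian g x.
Proof.
move=> [g1 g2]; apply/matrixP => i j; rewrite !mxE.
apply: derive_comm.
- by have [] := g1 (delta_mx i 0).
- by have [] := g1 (delta_mx j 0).
- by have [] := g2 (delta_mx i 0) (delta_mx j 0).
- by have [] := g2 (delta_mx j 0) (delta_mx i 0).
- by have [_ c] := g2 (delta_mx i 0) (delta_mx j 0); exact: c.
- by have [_ c] := g2 (delta_mx j 0) (delta_mx i 0); exact: c.
Qed.

Section slices.
Context (R : realType) (U V W : normedModType R) (u : V).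

Let quotient_slice (g : U * V -> W) (x a : U) :
  (fun h : R => h^-1 *: (((fun y => g (y, u)) \o shift x) (h *: a) - g (x, u))) =
  (fun h : R => h^-1 *: ((g \o shift (x, u)) (h *: (a, 0)) - g (x, u))).
Proof.
apply/funext => h /=; congr (_ *: (g _ - _)).
by congr pair; rewrite /= scaler0 add0r.
Qed.

Lemma derivable_slice (g : U * V -> W) (x a : U) :
  derivable g (x, u) (a, 0) -> derivable (fun y => g (y, u)) x a.
Proof. by rewrite /derivable quotient_slice. Qed.

Lemma derive_slice (g : U * V -> W) (x a : U) :
  derive (fun y => g (y, u)) x a = derive g (x, u) (a, 0).
Proof. by rewrite /derive quotient_slice. Qed.

Lemma continuous_slice (g : U * V -> W) :
  continuous g -> continuous (fun y => g (y, u)).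
Proof.
move=> cg x; apply: (@continuous_comp _ _ _ (fun y => (y, u)) g); last exact: cg.
by apply: cvg_pair => //; exact: cvg_cst.
Qed.

Lemma classC1_slice (g : U * V -> W) : classC1 g -> classC1 (fun y => g (y, u)).
Proof.
move=> g1 a; have [da ca] := g1 (a, 0); split => [x|].
  exact: derivable_slice.
under eq_fun do rewrite derive_slice.
exact: (continuous_slice ca).
Qed.

Lemma classC2_slice (g : U * V -> W) : classC2 g -> classC2 (fun y => g (y, u)).
Proof.
move=> [g1 g2]; split; first exact: classC1_slice.
move=> a; under eq_fun do rewrite derive_slice.
exact: classC1_slice (g2 (a, 0)).
Qed.

End slices.
(** * The cost of the linear-quadratic model *)

Lemma gaussian_sym_unit (d : measure_display) (Omega : measurableType d)
    (R : realType) (P : probability Omega R) n (X : {RV P >-> 'cV[R]_n})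
    (m : 'cV[R]_n) (S : 'M[R]_n) :
  gaussian X m S -> S^T = S /\ S \in unitmx.
Proof.
move=> gX; have [[ST _] _] := gX; split=> //.
by rewrite unitmxE unitfE gt_eqF// (gaussian_det_gt0 gX).
Qed.

(** Substituting the linearized dynamics in a quadratic function produces the
coefficients of the backward recursion. *)
Lemma qform_affine (R : realType) n (M F : 'M[R]_n) (N g x : 'cV[R]_n) (c : R) :
  M^T = M ->
  qform M N c (F *m x + g) =
  qform (F^T *m M *m F) (F^T *m M *m g + F^T *m N)
    (c + dotv g N + 2^-1 * dotv g (M *m g)) x.
Proof.
move=> MT; rewrite /qform !mulmxDr !dotvE -!mulmxA.
rewrite (dotv_mulmx F^T x) trmxK -!dotv_mulmx.
rewrite (dotvC g N) (dotvC (M *m g)) (dotv_sym g (F *m x) MT).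
by field.
Qed.

Lemma hessian_cost_sym (R : realType) (n m T : nat)
    (l : nat -> 'cV[R]_n -> 'cV[R]_m -> R) (lT : 'cV[R]_n -> R)
    (u : nat -> 'cV[R]_m) (t : nat) (x : 'cV[R]_n) :
  (forall t, (t < T)%N -> classC2 (fun z : 'cV[R]_n * 'cV[R]_m => l t z.1 z.2)) ->
  classC2 lT ->
  (hessian (cost_at T l lT u t) x)^T = hessian (cost_at T l lT u t) x.
Proof.
move=> lC2 lTC2; rewrite /cost_at; case: (ltnP t T) => [tT|_]; last exact: hessian_sym.
have ltC2 : classC2 (fun y => l t y (u t)) := classC2_slice (u t) (lC2 t tT).
exact: hessian_sym ltC2.
Qed.
Theorem mainTheorem3 (R : realType) (n m T : nat) (sigma : R)
    (f : nat -> 'cV[R]_n -> 'cV[R]_m -> 'cV[R]_n)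
    (l : nat -> 'cV[R]_n -> 'cV[R]_m -> R) (lT : 'cV[R]_n -> R)
    (u : nat -> 'cV[R]_m) (xn : nat -> 'cV[R]_n)
    (d : measure_display) (Omega : measurableType d) (P : probability Omega R)
    (xhat0 : 'cV[R]_n) (chi0 : 'M[R]_n) (Om : nat -> 'M[R]_n)
    (x0 : {RV P >-> 'cV[R]_n}) (w : nat -> {RV P >-> 'cV[R]_n})
    (sigma_neq0 : sigma != 0)
    (f_C2 : forall t, (t < T)%N ->
      classC2 (fun z : 'cV[R]_n * 'cV[R]_m => f t z.1 z.2))
    (l_C2 : forall t, (t < T)%N ->
      classC2 (fun z : 'cV[R]_n * 'cV[R]_m => l t z.1 z.2))
    (lT_C2 : classC2 lT)
    (x0_gaussian : gaussian x0 xhat0 chi0)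
    (w_gaussian : forall t, (1 <= t <= T)%N -> gaussian (w t) 0 (Om t))
    (noise_indep : mutually_independent (fun i : 'I_T.+1 => noise x0 w i))
    (* deviations of the linearized dynamics *)
    (dx : nat -> Omega -> 'cV[R]_n)
    (dx_0 : forall om, dx 0%N om = x0 om - xhat0)
    (dx_S : forall t, (t < T)%N -> forall om,
      dx t.+1 om = jacobian_col (fun x => f t x (u t)) (xn t) *m dx t om
                   + gap f u xn t.+1 + w t.+1 om) :
  let fx t := jacobian_col (fun x => f t x (u t)) (xn t) in
  let fbar := gap f u xn in
  let lbar t := cost_at T l lT u t (xn t) in
  let lx t := gradient (cost_at T l lT u t) (xn t) in
  let lxx t := hessian (cost_at T l lT u t) (xn t) in
  let L := Ltilde T lbar lx lxx dx in
  forall (V : nat -> 'M[R]_n) (v : nat -> 'cV[R]_n) (vbar : nat -> R),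
  let M := Mmx sigma Om V in
  let N := Nvec sigma Om V v in
  (* the backward recursion *)
  V T = lxx T -> v T = lx T -> vbar T = lbar T ->
  (forall t, (t < T)%N -> V t = lxx t + (fx t)^T *m M t *m fx t) ->
  (forall t, (t < T)%N ->
     v t = lx t + (fx t)^T *m M t *m fbar t.+1 + (fx t)^T *m N t) ->
  (forall t, (t < T)%N ->
     vbar t = lbar t + vbar t.+1 + dotv (fbar t.+1) (N t)
              + 2^-1 * dotv (fbar t.+1) (M t *m fbar t.+1)
              - 2^-1 * dotv (v t.+1)
                  (invmx (V t.+1 + sigma^-1 *: invmx (Om t.+1)) *m v t.+1)) ->
  (* well-definedness of the inverses V_{t+1}^{-1} and of J tilde *)
  (forall t, (1 <= t <= T)%N -> V t \in unitmx) ->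
  ('E_P[fun om => expR (- sigma * L om)] < +oo)%E ->
  Jtilde P sigma L =
    sigma^-1 * ln (alpha sigma chi0 Om V T) + vbar 0%N
    - 2^-1 * dotv (v 0%N) (invmx (V 0%N + sigma^-1 *: invmx chi0) *m v 0%N).

Proof.
move=> fx fbar lbar lx lxx L V v vbar M N VT vT vbarT Vrec vrec vbarrec unitV finE.
pose X := noise x0 w.
pose mean t : 'cV[R]_n := if t is 0 then xhat0 else 0.
pose S t := if t is 0 then chi0 else Om t.
have gaussX t : (t <= T)%N -> gaussian (X t) (mean t) (S t).
  by case: t => [//|t] tT; exact: w_gaussian.
have ST t : (t <= T)%N -> (S t)^T = S t.
  by move=> /gaussX/gaussian_sym_unit[].
have uS t : (t <= T)%N -> S t \in unitmx.
  by move=> /gaussX/gaussian_sym_unit[].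
have MT t : (t < T)%N -> (V t.+1)^T = V t.+1 -> (M t)^T = M t.
  move=> tT symV; rewrite /M /Mmx trmx_inv linearD/= linearZ/= trmx_inv symV.
  by rewrite (ST t.+1 tT).
have symV t : (t <= T)%N -> (V t)^T = V t.
  move=> tT; rewrite -(subKn tT).
  elim: (T - t)%N (leq_subr t T) => [_|j IH jT].
    by rewrite subn0 VT; exact: hessian_cost_sym.
  have kT : (T - j.+1 < T)%N by rewrite ltn_subrL (leq_trans _ jT).
  have {}IH := IH (ltnW jT); rewrite -subnSK// in IH.
  rewrite Vrec// linearD/= !trmx_mul trmxK (MT _ kT IH) mulmxA.
  by congr (_ + _); exact: hessian_cost_sym.
(* The recursion for [V], [v], [vbar] is the dynamic programming equation. *)
have bellman t : (t < T)%N -> 0 < \det (1%:M + sigma *: (V t.+1 *m S t.+1)) ->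
    forall x, qform (V t) (v t) (vbar t) x = qform (lxx t) (lx t) (lbar t) x +
    smoothed sigma (S t.+1) (V t.+1) (v t.+1) (vbar t.+1) (fx t *m x + fbar t.+1).
  move=> tT detD x.
  rewrite smoothedE ?symV ?ST ?uS ?unitV ?(gt_eqF detD)//.
  rewrite -/(M t) -/(N t).
  have := @qform_affine R n (M t) (fx t) (N t) (fbar t.+1) x
    (vbar t.+1 - 2^-1 * dotv (v t.+1)
       (invmx (V t.+1 + sigma^-1 *: invmx (S t.+1)) *m v t.+1))
    (MT t tT (symV t.+1 tT)).
  rewrite {1}/qform => ->.
  rewrite Vrec// vrec// vbarrec//.
  rewrite /qform !mulmxDl !dotvE /=; by field.
have dxS' t : (t < T)%N -> forall om,
    dx t.+1 om = fx t *m dx t om + fbar t.+1 + (X t.+1 om - mean t.+1).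
  by move=> tT om; rewrite dx_S// subr0.
have value_T x : qform (V T) (v T) (vbar T) x = qform (lxx T) (lx T) (lbar T) x.
  by rewrite VT vT vbarT.
have LE om : L om = \sum_(0 <= t < T.+1) qform (lxx t) (lx t) (lbar t) (dx t om).
  by rewrite /L /Ltilde; apply: eq_bigr => t _; rewrite /qform addrAC.
have finE' : (\int[P]_om (expR (- sigma * \sum_(0 <= t < T.+1)
    qform (lxx t) (lx t) (lbar t) (dx t om)))%:E < +oo)%E.
  move: finE; rewrite unlock; under eq_integral do rewrite LE; exact: id.
have [posD value] := @expected_cost _ _ _ _ _ _ sigma X mean S noise_indep gaussX
  fx fbar lxx lx lbar dx dx_0 dxS' V v vbar symV value_T bellman finE'.
rewrite /Jtilde unlock.
under eq_integral do rewrite LE.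
rewrite value /=.
set A := \prod_(0 <= t < T.+1) _.
have A0 : 0 < A.
  rewrite /A big_nat; apply: prodr_gt0 => t /andP[_ tT].
  by rewrite sqrtr_gt0; exact: posD.
have -> : alpha sigma chi0 Om V T = A.
  rewrite /alpha /A [in RHS]big_ltn//; congr (_ * _).
  by rewrite !big_nat; apply: eq_bigr => -[].
rewrite lnM ?posrE ?invr_gt0 ?expR_gt0// lnV ?posrE// expRK.
have uchi0 : chi0 \in unitmx := uS 0%N isT.
rewrite smoothed_at0 ?uchi0 ?(gt_eqF (posD 0%N _))//.
by field.
Qed.
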